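(* Suppose that $X$ is compact. If at each step $k$ of the semidefinite relaxation (exchange) algorithm described in the context, applied to the semi-infinite polynomial program $(P)$, (a) the subproblem $(P_k)$ and each subproblem $(Q_i^k)$ are globally solved, (b) the intermediate results $S_k$ and at least one $T_i^k$ are nonempty, then either the algorithm stops with solutions to $(P)$ in a finite number of iterations, or for any sequence $\{x^k\}$ with $x^k\in S_k$, there exists at least one limit point as $k$ increases and each limit point solves $(P)$.
   Context: Problem $(P)$: $f^*:=\min_{x\in X} f(x)$ subject to $g(x,u)\ge 0$ for all $u\in U$, where $X=\{x\in\mathbb{R}^n\mid \theta_1(x)\ge 0,\dots,\theta_{m_2}(x)\ge 0\}$ and $U=\{u\in\mathbb{R}^p\mid h_1(u)\ge 0,\dots,h_{m_1}(u)\ge 0\}$. Here $f,\theta_i$ are polynomials in $x\in\mathbb{R}^n$, $h_j$ are polynomials in $u\in\mathbb{R}^p$, and $g$ is a polynomial in $(x,u)\in\mathbb{R}^n\times\mathbb{R}^p$. Throughout, $X$ is assumed compact and $U$ is assumed to be an infinite index set. Algorithm (semidefinite relaxations for semi-infinite polynomial programming). Input: $f$, $g$, the semialgebraic sets $X$, $U$, a tolerance $\epsilon$ and a maximum iteration number $k_{\max}$. Output: the global optimum $f^*$ and a set $X^*$ of minimizers of $(P)$. Step 1: Choose a random $u_0\in U$ and let $U_0=\{u_0\}$. Set $X^*=\emptyset$ and $k=0$. Step 2: Use Lasserre's SDP relaxation to solve $(P_k)$: $f_k^{\min}:=\min_{x\in X} f(x)$ subject to $g(x,u)\ge 0$ for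 all $u\in U_k$. Let $S_k=\{x_1^k,\dots,x_{r_k}^k\}$ be the set of global minimizers of $(P_k)$. Step 3: Set $U_{k+1}=U_k$. For $i=1,\dots,r_k$: (i) use Nie's Jacobian SDP relaxation to solve $(Q_i^k)$: $g_i^k:=\min_{u\in U} g(x_i^k,u)$, and let $T_i^k=\{u_{i,j}^k,\ j=1,\dots,t_i^k\}$ be the set of global minimizers of $(Q_i^k)$; (ii) update $U_{k+1}=U_{k+1}\cup T_i^k$; (iii) if $g_i^k\ge-\epsilon$, update $X^*=X^*\cup\{x_i^k\}$. Step 4: If $X^*\ne\emptyset$ or $k>k_{\max}$, stop; otherwise set $k=k+1$ and go back to Step 2. The two solvers named above apply to polynomial optimization problems with finitely many polynomial equality and inequality constraints. Lasserre's SDP relaxation solves, for increasing order, the semidefinite programs maximizing $\gamma$ such that the objective minus $\gamma$ lies in the truncated quadratic module generated by the constraints, together with their dual moment programs, and extracts global minimizers when a flat truncation (rank stabilization) condition holds for the optimal moment matrix. Nie's Jacobian SDP relaxation first adds auxiliary polynomial equations expressing that, at an optimizer, the Jacobian of the objective, equality constraints and active inequality constraints is rank deficient, and then applies Lasserre's SDP relaxation to the augmented problem.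
   Formalization: U is additionally assumed compact (the claim fails for unbounded U), and for tolerance ε > 0 ''stops with solutions'' means points of X with g ≥ -ε on U and f at most the optimal value of (P), exact solutions when ε = 0; no iteration cap k_max is imposed. *)

(* Defs.v *)
(* multinomials is not Imported: its notations clash with those of analysis. *)
From HB Require Import structures.
From mathcomp Require Import all_boot all_order all_algebra.
From mathcomp Require Import all_classical all_reals all_analysis.
From mathcomp Require mpoly.

Set Implicit Arguments.
Unset Strict Implicit.
Unset Printing Implicit Defensive.

Import Order.TTheory GRing.Theory Num.Theory.
Import numFieldNormedType.Exports.

Local Open Scope classical_set_scope.
Local Open Scope ring_scope.

Definition peval (R : realType) (n : nat) (q : mpoly.mpoly n R)
    (x : 'rV[R]_n) : R :=
  mpoly.meval (fun i : 'I_n => x ord0 i) q.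

Definition minimizers (R : realType) (V : Type) (C : set V) (phi : V -> R) :
    set V :=
  [set x | C x /\ forall y, C y -> phi x <= phi y].

(* In g, the first n variables are x and the last p ones are u. *)
Record sipp (R : realType) (n p m1 m2 : nat) := Sipp {
  f_poly : mpoly.mpoly n R;
  g_poly : mpoly.mpoly (n + p) R;
  theta_poly : 'I_m2 -> mpoly.mpoly n R;
  h_poly : 'I_m1 -> mpoly.mpoly p R
}.

Section SemiInfiniteProgram.
Context {R : realType} {n p m1 m2 : nat}.
Variable P : sipp R n p m1 m2.

Definition obj (x : 'rV[R]_n) : R := peval (f_poly P) x.

Definition ctr (x : 'rV[R]_n) (u : 'rV[R]_p) : R :=
  peval (g_poly P) (row_mx x u).

Definition Xset : set 'rV[R]_n :=
  [set x | forall i, 0 <= peval (theta_poly P i) x].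

Definition Uset : set 'rV[R]_p :=
  [set u | forall j, 0 <= peval (h_poly P j) u].

(* Feasible set of the program whose index set is I: (P) is the case
   I = Uset, and (P_k) the case I = U_k. *)
Definition feasible (I : set 'rV[R]_p) : set 'rV[R]_n :=
  [set x | Xset x /\ forall u, I u -> 0 <= ctr x u].

Definition solutions (I : set 'rV[R]_p) : set 'rV[R]_n :=
  minimizers (feasible I) obj.

(* For eps = 0 this is [solutions Uset]. *)
Definition tol_solutions (eps : R) : set 'rV[R]_n :=
  [set x | [/\ Xset x,
               forall u, Uset u -> - eps <= ctr x u &
               forall y, feasible Uset y -> obj x <= obj y]].

(* Optimal value of (Q) at the point x. *)
Definition gmin (x : 'rV[R]_n) : \bar R :=
  ereal_inf [set (ctr x u)%:E | u in Uset].

Section Run.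
Variables (eps : R) (u0 : 'rV[R]_p).
(* S k is the output of the solver on (P_k); T k x is its output on the
   problem (Q) attached to the point x of S k. *)
Variables (S : nat -> seq 'rV[R]_n) (T : nat -> 'rV[R]_n -> seq 'rV[R]_p).

Fixpoint Uk (k : nat) : set 'rV[R]_p :=
  if k is j.+1 then Uk j `|` \bigcup_(x in [set` S j]) [set` T j x]
  else [set u0].

(* The accumulated set X^* when the stopping test of iteration k is made. *)
Fixpoint Xstar (k : nat) : set 'rV[R]_n :=
  (if k is j.+1 then Xstar j else set0)
    `|` [set x | x \in S k /\ ((- eps)%:E <= gmin x)%E].

Definition stops_at (k : nat) : Prop := Xstar k !=set0.

Definition reached (k : nat) : Prop := forall j, (j < k)%N -> ~ stops_at j.

Definition globally_solved (k : nat) : Prop :=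
  [set` S k] = solutions (Uk k) /\
  forall x, x \in S k -> [set` T k x] = minimizers Uset (ctr x).

Definition nonempty_results (k : nat) : Prop :=
  S k <> [::] /\ exists2 x, x \in S k & T k x <> [::].

End Run.
End SemiInfiniteProgram.

(* Main.v *)
Require Import Defs.
From HB Require Import structures.
From mathcomp Require Import all_boot all_order all_algebra.
From mathcomp Require Import all_classical all_reals all_analysis.
From mathcomp Require mpoly.

Set Implicit Arguments.
Unset Strict Implicit.
Unset Printing Implicit Defensive.

Import Order.TTheory GRing.Theory Num.Theory.
Import numFieldNormedType.Exports.

Local Open Scope classical_set_scope.
Local Open Scope ring_scope.

(** The reason is a compactness argument on the cuts that the exchange step
    generates.

    If some iteration stops, take the first one, k.  The accumulated set is
    then made of points of S k whose worst constraint violation is at most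
    eps.  Such a point minimizes the objective over the relaxed program (P_k),
    whose feasible set contains that of (P) since U_k is a subset of U; so it
    does at least as well as every feasible point of (P), and it is itself
    feasible when eps = 0.

    If no iteration stops, every x^k minimizes the objective over (P_k), so
    f(x^k) <= f(y) for all y feasible for (P); this bound and membership in X
    are closed conditions, hence hold at every cluster point a.  The point to
    settle is feasibility of a ([exchange_cluster_ge0]).  Let u^k be a worst
    index at x^k; one exists because U is compact, and it belongs to T k (x^k)
    because that set collects all of them.  As u^j enters U_k for every k > j,
    the constraint of index u^j holds at all later x^k and therefore at a.  If
    some v in U had g(a, v) < 0, then for x^k close to a we would have
    g(x^k, u^k) <= g(x^k, v) < g(a, v) / 2 while g(a, u^k) >= 0.  This
    contradicts the fact that g(x, .) is uniformly close to g(a, .) on the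
    compact set U for x close to a ([compact_near_uniform]). *)

(** * Topology *)

Lemma closed_cluster (T : topologicalType) (F : set_system T) (C : set T) :
  closed C -> F C -> cluster F `<=` C.
Proof. by move=> cC FC a; rewrite clusterE => /(_ _ FC); exact: cC. Qed.

Lemma closed_preimage_ge0 (T : topologicalType) (R : realType) (f : T -> R) :
  continuous f -> closed [set x | 0 <= f x].
Proof.
move=> cf; apply: (@preimage_closed _ _ f [set y | 0 <= y]).
  by move=> x _; exact: cf.
exact: closed_ge.
Qed.

Lemma continuous_uncurry_comp (T X U V : topologicalType) (phi : X -> U -> V)
    (f : T -> X) (g : T -> U) :
  continuous (fun z : X * U => phi z.1 z.2) -> continuous f -> continuous g ->
  continuous (fun t => phi (f t) (g t)).
Proof.
move=> cphi cf cg t.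
have cfg : (f s, g s) @[s --> t] --> (f t, g t).
  by apply: cvg_pair; [exact: cf | exact: cg].
exact: cvg_comp cfg (cphi (f t, g t)).
Qed.

(** The half of uniform convergence used below: compactness of K makes the
    neighbourhood of a independent of the point v of K. *)
Lemma compact_near_uniform (X U : topologicalType) (R : realType)
    (phi : X -> U -> R) (K : set U) (a : X) (e : R) :
  compact K -> continuous (fun z : X * U => phi z.1 z.2) -> 0 < e ->
  \forall x \near a, forall v, K v -> phi a v - e < phi x v.
Proof.
move=> /compact_near_coveringP cK cphi e0.
have near_phi (v : U) : \forall v' \near v & x \near a, phi a v' - e < phi x v'.
  pose d (z : U * X) := phi z.2 z.1 - phi a z.1.
  have cd : continuous d.
    move=> z; apply: continuousB; apply: (continuous_uncurry_comp cphi).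
    - by move=> ?; exact: cvg_snd.
    - by move=> ?; exact: cvg_fst.
    - by move=> ?; exact: cvg_cst.
    - by move=> ?; exact: cvg_fst.
  have near_d : nbhs (d (v, a)) [set r | - e < r].
    by apply: lt_nbhsr; rewrite /d subrr oppr_lt0.
  apply: (@filterS _ (filter_prod (nbhs v) (nbhs a)) _ _ _ _ (cd _ _ near_d)).
  by move=> -[v' x] /=; rewrite /d ltrBrDl.
apply: (cK X (nbhs a) (fun x v => phi a v - e < phi x v) _) => v _.
exact: near_phi.
Qed.

(** * The exchange method *)

(** Each cut u j is imposed on all later iterates, so it holds at the cluster
    point a; and u k is a worst index at x k, so the constraints at x k are
    controlled by cuts that a satisfies. *)
Lemma exchange_cluster_ge0 (X U : topologicalType) (R : realType)
    (phi : X -> U -> R) (K : set U) (x : nat -> X) (u : nat -> U) (a : X) :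
  compact K -> continuous (fun z : X * U => phi z.1 z.2) ->
  (forall k, minimizers K (phi (x k)) (u k)) ->
  (forall j k, (j < k)%N -> 0 <= phi (x k) (u j)) ->
  cluster (x @ \oo) a ->
  forall v, K v -> 0 <= phi a v.
Proof.
move=> cK cphi umin cut xa v Kv; rewrite leNgt; apply/negP => av0.
have cphil w : continuous (phi^~ w).
  apply: (continuous_uncurry_comp cphi) => y; first exact: cvg_id.
  exact: cvg_cst.
have cut_a j : 0 <= phi a (u j).
  apply: (closed_cluster (closed_preimage_ge0 (cphil (u j)))) xa.
  by exists j.+1 => // k; exact: cut.
(* The slack phi a v / 2 is split: phi y v stays below it, while phi y w stays
   above it at every w with phi a w >= 0. *)
have e0 : 0 < - (phi a v / 2) by rewrite oppr_gt0 pmulr_llt0 ?invr_gt0.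
have near_a : \forall y \near a, phi y v < phi a v / 2 /\
    forall w, K w -> phi a w - - (phi a v / 2) < phi y w.
  apply: filterI; last exact: compact_near_uniform.
  apply: (cphil v a [set r | r < phi a v / 2]); apply: lt_nbhsl.
  by rewrite -subr_lt0 {1}(splitr (phi a v)) addrK -oppr_gt0.
have [_ [[k _ <-] [xv xw]]] : range x `&`
    [set y | phi y v < phi a v / 2 /\
      forall w, K w -> phi a w - - (phi a v / 2) < phi y w] !=set0.
  by apply: xa near_a; exists 0%N => // k _; exists k.
have [Ku umink] := umin k.
move: (lt_trans (lt_le_trans (xw _ Ku) (umink _ Kv)) xv).
by rewrite opprK gtrDr ltNge cut_a.
Qed.

(** * Continuity of the data of the program *)

Lemma continuous_peval (T : topologicalType) (R : realType) (n : nat)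
    (q : mpoly.mpoly n R) (F : T -> 'rV[R]_n) :
  (forall i, continuous (fun t => F t ord0 i)) ->
  continuous (fun t => peval q (F t)).
Proof.
move=> cF; rewrite /peval.
under eq_fun do rewrite mpoly.mevalE.
move=> t; apply: (cvg_big (@add_continuous R^o)) => m _.
apply: cvgM; first exact: cvg_cst.
apply: (cvg_big (@mul_continuous R)) => i _.
exact: (cvg_comp _ _ (cF i t) (@exprn_continuous _ _ _)).
Qed.

Section SemiInfiniteProgram.
Context {R : realType} {n p m1 m2 : nat}.
Variable P : sipp R n p m1 m2.

Lemma continuous_obj : continuous (obj P).
Proof. by apply: continuous_peval => i; exact: coord_continuous. Qed.

Lemma continuous_ctr :
  continuous (fun z : 'rV[R]_n * 'rV[R]_p => ctr P z.1 z.2).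
Proof.
apply: continuous_peval => i z.
rewrite /continuous_at mxE.
under eq_fun do rewrite mxE.
case: (fintype.split i) => j.
- apply: (@continuous_comp _ _ _ fst (fun M : 'rV[R]_n => M ord0 j)).
    exact: cvg_fst.
  exact: coord_continuous.
- apply: (@continuous_comp _ _ _ snd (fun M : 'rV[R]_p => M ord0 j)).
    exact: cvg_snd.
  exact: coord_continuous.
Qed.

Lemma continuous_ctrr (x : 'rV[R]_n) : continuous (ctr P x).
Proof.
apply: (continuous_uncurry_comp (f := fun=> x) continuous_ctr) => u.
  exact: cst_continuous.
exact: cvg_id.
Qed.

Lemma minimizers_ctr_neq0 (x : 'rV[R]_n) :
  compact (Uset P) -> Uset P !=set0 -> minimizers (Uset P) (ctr P x) !=set0.
Proof.
move=> cU U0; have [|u /set_mem Uu umin] := EVT_min_rV U0 cU (f := ctr P x).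
  by apply: continuous_subspaceT; exact: continuous_ctrr.
by exists u; split => // v Uv; apply: umin; exact/mem_set.
Qed.

Lemma closed_Xset : closed (Xset P).
Proof.
rewrite [Xset P](_ : _ = \bigcap_i [set x | 0 <= peval (theta_poly P i) x]).
  apply: closed_bigI => i _; apply: closed_preimage_ge0.
  by apply: continuous_peval => j; exact: coord_continuous.
by apply/seteqP; split => x Xx => [i _|i]; apply: Xx.
Qed.

Lemma feasibleS (I J : set 'rV[R]_p) :
  I `<=` J -> feasible P J `<=` feasible P I.
Proof. by move=> IJ x [Xx xJ]; split => // u /IJ; exact: xJ. Qed.

Lemma gmin_ge (e : R) (x : 'rV[R]_n) :
  ((- e)%:E <= gmin P x)%E -> forall u, Uset P u -> - e <= ctr P x u.
Proof.
move=> /[swap] u /[swap] Uu; rewrite -lee_fin => /le_trans; apply.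
by apply: ereal_inf_lbound; exists u.
Qed.

(** * Runs of the algorithm *)

Section Run.
Variables (eps : R) (u0 : 'rV[R]_p).
Variables (S : nat -> seq 'rV[R]_n) (T : nat -> 'rV[R]_n -> seq 'rV[R]_p).
Hypothesis u0_in_U : Uset P u0.
Hypothesis solved :
  forall k, reached P eps S k -> globally_solved P u0 S T k.

Lemma reachedW (j k : nat) :
  (j <= k)%N -> reached P eps S k -> reached P eps S j.
Proof. by move=> jk rk i ij; apply: rk; exact: leq_trans jk. Qed.

Lemma Uk_sub (k : nat) : reached P eps S k -> Uk u0 S T k `<=` Uset P.
Proof.
elim: k => [_ u ->//|k IHk rk]; have rk' := reachedW (leqnSn k) rk.
move=> u [|[x /= xk uT]]; first exact: IHk.
by have : [set` T k x] u := uT; rewrite (solved rk').2// => -[].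
Qed.

Lemma Uk_mono (j k : nat) : (j <= k)%N -> Uk u0 S T j `<=` Uk u0 S T k.
Proof.
move/subnKC <-; elim: (k - j)%N => [|i IHi]; rewrite ?addn0// addnS.
by move=> u /IHi; left.
Qed.

Lemma iterate_solution (k : nat) (x : 'rV[R]_n) :
  reached P eps S k -> x \in S k -> solutions P (Uk u0 S T k) x.
Proof. by move=> rk xk; rewrite -(solved rk).1. Qed.

(** The program solved at iteration k is a relaxation of the full one. *)
Lemma iterate_obj_le (k : nat) (x y : 'rV[R]_n) :
  reached P eps S k -> x \in S k -> feasible P (Uset P) y ->
  obj P x <= obj P y.
Proof.
move=> rk xk Fy; apply: (iterate_solution rk xk).2.
by apply: feasibleS Fy; exact: Uk_sub.
Qed.

(** No earlier iteration has stopped, so the points collected so far all come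
    from the current one. *)
Lemma Xstar_reached (k : nat) : reached P eps S k ->
  Xstar P eps S k = [set x | x \in S k /\ ((- eps)%:E <= gmin P x)%E].
Proof.
case: k => [_|k rk] /=; first by rewrite set0U.
have -> : Xstar P eps S k = set0 by apply/nonemptyPn/rk.
by rewrite set0U.
Qed.

Lemma Xstar_tol_solutions (k : nat) :
  reached P eps S k -> Xstar P eps S k `<=` tol_solutions P eps.
Proof.
move=> rk; rewrite Xstar_reached// => x [xk gx]; split.
- by case: (iterate_solution rk xk) => -[].
- exact: gmin_ge.
- by move=> y; exact: iterate_obj_le rk xk.
Qed.

Lemma exchange_cut (x : nat -> 'rV[R]_n) (u : nat -> 'rV[R]_p) :
  (forall k, reached P eps S k) ->
  (forall k, x k \in S k) -> (forall k, u k \in T k (x k)) ->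
  forall j k, (j < k)%N -> 0 <= ctr P (x k) (u j).
Proof.
move=> r xS uT j k jk; have [[_ xk] _] := iterate_solution (r k) (xS k).
by apply: xk; apply: (Uk_mono jk); right; exists (x j); [exact: xS | exact: uT].
Qed.

End Run.

Lemma tol_solutions0 : tol_solutions P 0 `<=` solutions P (Uset P).
Proof.
by move=> x [Xx gx fx]; split => //; split=> // u /gx; rewrite oppr0.
Qed.

End SemiInfiniteProgram.

Theorem theorem3p4 (R : realType) (n p m1 m2 : nat) (P : sipp R n p m1 m2)
    (eps : R) (u0 : 'rV[R]_p)
    (S : nat -> seq 'rV[R]_n) (T : nat -> 'rV[R]_n -> seq 'rV[R]_p)
    (eps_ge0 : 0 <= eps)
    (X_compact : compact (Xset P))
    (U_compact : compact (Uset P))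
    (U_infinite : infinite_set (Uset P))
    (u0_in_U : Uset P u0)
    (solved : forall k, reached P eps S k -> globally_solved P u0 S T k)
    (nonempty : forall k, reached P eps S k -> nonempty_results S T k) :
  (exists k, [/\ reached P eps S k,
                 stops_at P eps S k,
                 Xstar P eps S k `<=` tol_solutions P eps &
                 eps = 0 -> Xstar P eps S k `<=` solutions P (Uset P)])
  \/
  ((forall k, ~ stops_at P eps S k) /\
   forall x : nat -> 'rV[R]_n, (forall k, x k \in S k) ->
     cluster (x @ \oo) !=set0 /\
     cluster (x @ \oo) `<=` solutions P (Uset P)).
Proof.
have [[k0 st0]|nost] := pselect (exists k, stops_at P eps S k).
  (* Iterations after the first stopping one are never reached. *)
  left; pose stop k := `[< stops_at P eps S k >].
  have exstop : exists k, stop k by exists k0; apply/asboolP.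
  case: (ex_minnP exstop) => k /asboolP st kmin.
  have rk : reached P eps S k.
    by move=> j jk /asboolP /kmin; rewrite leqNgt jk.
  have tol := Xstar_tol_solutions u0_in_U solved rk.
  exists k; split => // e0; apply: subset_trans tol _.
  by rewrite e0; exact: tol_solutions0.
have nostop k : ~ stops_at P eps S k by move=> st; apply: nost; exists k.
right; split => // x xS.
have r k : reached P eps S k by move=> j _; exact: nostop.
have xX k : Xset P (x k) by case: (iterate_solution solved (r k) (xS k)) => -[].
split.
  have [|a [_ xa]] := X_compact (x @ \oo) _; last by exists a.
  by exists 0%N => // k _; exact: xX.
have umin_ex k : exists u, minimizers (Uset P) (ctr P (x k)) u.
  by apply: minimizers_ctr_neq0 => //; exists u0.
have [u umin] := choice umin_ex.
(* T k (x k) holds every minimizer, in particular the chosen one. *)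
have uT k : u k \in T k (x k).
  by have := umin k; rewrite -((solved k (r k)).2 _ (xS k)).
move=> a xa; split; first split.
- apply: (closed_cluster (@closed_Xset _ _ _ _ _ P)) xa.
  by exists 0%N => // k _; exact: xX.
- apply: (exchange_cluster_ge0 U_compact (@continuous_ctr _ _ _ _ _ P) umin) xa.
  exact: (exchange_cut solved r xS uT).
- move=> y Fy; apply: (closed_cluster (C := [set z | obj P z <= obj P y])) xa.
    apply: (@preimage_closed _ _ (obj P) [set c | c <= obj P y]).
      by move=> z _; exact: continuous_obj.
    exact: closed_le.
  exists 0%N => // k _ /=.
  exact: (iterate_obj_le u0_in_U solved (r k) (xS k)).
Qed.
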